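(* Let $L$ be a compactly generated multiplicative lattice with $1$ compact, and suppose that $L$ satisfies the max-bounded property. If a class $\Sigma_L$ of elements of $L$ contains all the maximal elements of $L$, then the lower space $\Sigma_L$ is compact.
   Context: A multiplicative lattice is a complete lattice $(L,\leqslant,0,1)$ with a binary operation $\cdot$ that is associative, commutative, satisfies $x\cdot 1=x$, and satisfies $x\cdot\bigvee_{\lambda\in\Lambda}y_\lambda=\bigvee_{\lambda\in\Lambda}(x\cdot y_\lambda)$ for all $x\in L$ and all families $(y_\lambda)_{\lambda\in\Lambda}$ in $L$. $x^n$ is the $n$-fold product. Element $x$ is proper if $x\neq 1$. A proper $p$ is prime if $x\cdot y\leqslant p$ implies $x\leqslant p$ or $y\leqslant p$; a prime $p$ is minimal prime if there is no prime $q\neq p$ with $q\leqslant p$. A proper $m$ is maximal if $m\leqslant n$ and $n\neq 1$ imply $m=n$. An element $c$ is compact if $c\leqslant\bigvee_{\lambda\in\Lambda}x_\lambda$ implies $c\leqslant\bigvee_{i=1}^n x_{\lambda_i}$ for some finite subfamily. $x$ is idempotent if $x\cdot x=x$, nilpotent if $x^n=0$ for some $n\geq 1$. The radical of $x$ is $\sqrt{x}=\bigvee\{y\in L\mid y \text{ compact},\ y^n\leqslant x \text{ for some } n\geq 1\}=\bigwedge\{p \text{ prime}\mid x\leqslant p\}$ (the two expressions are taken to agree); $r$ is a radical element if $r=\sqrt r$. $q$ is primary if $x\cdot y\leqslant q$ implies $x\leqslant q$ or $y\leqslant\sqrt q$. $s$ is strongly irreducible if $x\wedge y\leqslant s$ implies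 $x\leqslant s$ or $y\leqslant s$; irreducible if $x\wedge y=s$ implies $x=s$ or $y=s$; completely irreducible if $s=\bigwedge_{\lambda\in\Lambda}x_\lambda$ implies $s=x_\lambda$ for some $\lambda$. A class $\Sigma_L$ of elements of $L$ is any one of the sets of: proper, prime, minimal prime, maximal, compact, idempotent, nilpotent, radical, primary, strongly irreducible, irreducible, completely irreducible elements of $L$. For $x\in L$ put $v(x)=\{l\in\Sigma_L\mid x\leqslant l\}$. The lower space $\Sigma_L$ is the set $\Sigma_L$ with the lower topology, i.e. the topology for which $\{v(x)\mid x\in L\}$ is a subbasis of closed sets. $L$ is compactly generated if every element is a join of compact elements. $L$ satisfies the max-bounded property if for every proper $x\in L$ there is a maximal element $m$ of $L$ with $x\leqslant m$. Compactness of a space means every open cover has a finite subcover (no separation axiom). *)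

(* Defs.v *)
From HB Require Import structures.
From mathcomp Require Import all_boot all_order.
From mathcomp Require Import boolp classical_sets functions cardinality.
From mathcomp Require Import topology.

Set Implicit Arguments.
Unset Strict Implicit.
Unset Printing Implicit Defensive.

Import Order.LTheory.

Local Open Scope classical_set_scope.
Local Open Scope group_scope.
Local Open Scope order_scope.

(* [supremum] and [infimum] only mean what they say on sets that have a least
   upper (greatest lower) bound; the default value is the right one for the
   empty set. *)
Definition lsup d (T : tbLatticeType d) (S : set T) : T := supremum \bot S.
Definition linf d (T : tbLatticeType d) (S : set T) : T := infimum \top S.

(* The operation and its neutral element come from the monoid structure, the
   elements 0 and 1 of the lattice are [\bot] and [\top]. Joins of families
   are joins of their sets of values, empty families included; in particular
   x * \bot = \bot. *)
HB.mixin Record Monoid_TBLattice_isMultLattice (d : Order.disp_t) T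
    of Monoid T & Order.TBLattice d T := {
  mul_comm : commutative (@mul T);
  one_top : 1 = \top :> T;
  sup_exists : forall S : set T, supremums S !=set0;
  mul_sup : forall (x : T) (S : set T),
    x * lsup S = lsup [set x * y | y in S]
}.

#[short(type="multLatticeType")]
HB.structure Definition MultLattice (d : Order.disp_t) :=
  { T of Monoid T & Order.TBLattice d T & Monoid_TBLattice_isMultLattice d T }.

Section BoundsTheory.
Context {d : Order.disp_t} {L : multLatticeType d}.
Implicit Types (S : set L) (x y : L).

Lemma lsupP S : supremums S (lsup S).
Proof.
rewrite /lsup /supremum; case: ifPn => [/eqP ->|_].
  by split=> [y []|y _]; rewrite le0x.
by have [y Sy] := sup_exists S; apply: xgetPex; exists y.
Qed.

Lemma linfP S : infimums S (linf S).
Proof.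
rewrite /linf /infimum; case: ifPn => [/eqP ->|_].
  by split=> [y []|y _]; rewrite lex1.
have [y [yub ylb]] := sup_exists (lbound S).
apply: xgetPex; exists y; split=> [s Ss|z Sz]; last exact: yub.
by apply: ylb => z; apply.
Qed.

End BoundsTheory.

Section Elements.
Context {d : Order.disp_t} {L : multLatticeType d}.
Implicit Types (c l m n p q r s x y : L).

Definition proper_elt x := x != \top.

Definition prime_elt p :=
  proper_elt p /\ forall x y, x * y <= p -> x <= p \/ y <= p.

Definition minimal_prime_elt p :=
  prime_elt p /\ forall q, prime_elt q -> q <= p -> q = p.

Definition maximal_elt m :=
  proper_elt m /\ forall n, m <= n -> n != \top -> m = n.

Definition compact_elt c :=
  forall S : set L, c <= lsup S ->
    exists F : set L, [/\ finite_set F, F `<=` S & c <= lsup F].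

Definition idempotent_elt x := x * x = x.

Definition nilpotent_elt x := exists2 n : nat, (0 < n)%N & x ^+ n = \bot.

(* The radical as a join of compact elements. It is also the meet of the
   primes above x when L is compactly generated and products of compact
   elements are compact. *)
Definition radical x : L :=
  lsup [set y | compact_elt y /\ exists2 n : nat, (0 < n)%N & y ^+ n <= x].

Definition radical_elt r := r = radical r.

Definition primary_elt q :=
  forall x y, x * y <= q -> x <= q \/ y <= radical q.

Definition strongly_irreducible_elt s :=
  forall x y, Order.meet x y <= s -> x <= s \/ y <= s.

Definition irreducible_elt s :=
  forall x y, Order.meet x y = s -> x = s \/ y = s.

Definition completely_irreducible_elt s :=
  forall S : set L, s = linf S -> S s.

Definition compactly_generated :=
  forall x, exists2 S : set L, S `<=` compact_elt & x = lsup S.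

Definition max_bounded :=
  forall x, proper_elt x -> exists2 m, maximal_elt m & x <= m.

End Elements.

Arguments compactly_generated {d} L.
Arguments max_bounded {d} L.

Inductive elt_class :=
  | Proper | Prime | MinimalPrime | Maximal | Compact | Idempotent
  | Nilpotent | Radical | Primary | StronglyIrreducible | Irreducible
  | CompletelyIrreducible.

Definition class_set d (L : multLatticeType d) (k : elt_class) : set L :=
  match k with
  | Proper => [set x | proper_elt x]
  | Prime => prime_elt
  | MinimalPrime => minimal_prime_elt
  | Maximal => maximal_elt
  | Compact => compact_elt
  | Idempotent => idempotent_elt
  | Nilpotent => nilpotent_elt
  | Radical => radical_elt
  | Primary => primary_elt
  | StronglyIrreducible => strongly_irreducible_elt
  | Irreducible => irreducible_elt
  | CompletelyIrreducible => completely_irreducible_elt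
  end.
Arguments class_set {d} L k.

Definition lower_space d (L : multLatticeType d) (Sigma : set L) : Type :=
  set_type Sigma.

Section LowerTopology.
Context {d : Order.disp_t} {L : multLatticeType d} (Sigma : set L).

HB.instance Definition _ := Choice.on (lower_space Sigma).

Definition vset (x : L) : set (lower_space Sigma) :=
  [set l | x <= set_val l].

(* The complements of the sets [vset x] form a subbase of open sets. *)
HB.instance Definition _ := isSubBaseTopological.Build (lower_space Sigma)
  [set ~` vset x | x in [set: L]] id.

End LowerTopology.

(* Main.v *)
Require Import Defs.
From HB Require Import structures.
From mathcomp Require Import all_boot all_order finmap.
From mathcomp Require Import boolp classical_sets functions cardinality.
From mathcomp Require Import topology.

(** An ultrafilter on the lower space converges to a point [l] as soon as [l]
    lies above the join [j] of all [x] such that [v(x)] belongs to the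
    ultrafilter. If [j] is proper, a maximal element above [j] is such a point.
    If [j] is [1], then by compactness of [1] the set [v(1)], a finite
    intersection of sets [v(x)], belongs to the ultrafilter, so it is nonempty
    and [1] itself is a point of the space. *)

Set Implicit Arguments.
Unset Strict Implicit.
Unset Printing Implicit Defensive.

Import Order.LTheory.

Local Open Scope classical_set_scope.

(* [compact_cover] assumes a pointed space; empty spaces are handled apart. *)
Lemma compact_setT_cover (T : topologicalType) :
  compact [set: T] -> cover_compact [set: T].
Proof.
move=> cT I D f fop fcov.
have [[p _]|T0] := pselect ([set: T] !=set0); last first.
  by exists fset0 => // x _; case: T0; exists x.
pose PT : ptopologicalType := HB.pack (T : Type) T (isPointed.Build T p).
have : @compact PT [set: T] by exact: cT.
by rewrite compact_cover => /(_ I D f fop fcov).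
Qed.

Section LowerSpace.
Context {d : Order.disp_t} {L : multLatticeType d} (Sigma : set L).
Implicit Types (x : L) (l : lower_space Sigma).

(** Basic neighbourhoods of [l] are finite intersections of complements of sets [vset x] with [x]
    not below [l], and [F] is closed under finite intersections. *)
Lemma lower_space_cvg (F : set_system (lower_space Sigma)) l : Filter F ->
  (forall x, ~ (x <= set_val l)%O -> F (~` vset x)) -> F --> l.
Proof.
move=> FF Fl A.
rewrite /= nbhsE => -[B [[G GI <-] [C GC Cl]] /filterS]; apply.
apply: (@filterS _ F _ C); first by move=> m Cm; exists C.
have [D' sD' eC] := GI _ GC.
rewrite -eC; apply: filter_bigI => E ED'.
have [x _ eE] : [set ~` vset x | x in [set: L]] E by exact/set_mem/sD'.
rewrite -eE; apply: Fl => xl.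
by move: Cl; rewrite -eC => /(_ _ ED'); rewrite -eE; apply.
Qed.

(** A point above every [x] in [S] is above [lsup S], so [vset (lsup S)] contains a finite
    intersection of members of [F]. *)
Lemma filter_vset_lsup (F : set_system (lower_space Sigma)) (S : set L) :
  Filter F -> finite_set S -> (forall x, S x -> F (vset x)) -> F (vset (lsup S)).
Proof.
move=> FF /finite_fsetP[D ->] FD.
have : F (\bigcap_(x in [set` D]) vset x) by exact: filter_bigI.
apply: filterS => l lS; have [_] := lsupP [set` D]; apply => x; exact: lS.
Qed.

Lemma lower_space_compact :
  compact_elt (\top%O : L) -> max_bounded L ->
  (forall m : L, maximal_elt m -> Sigma m) ->
  compact [set: lower_space Sigma].
Proof.
move=> top_cpt maxb maxS; rewrite compact_ultra => F FU _.
pose S := [set x : L | F (vset x)].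
suff [l jl] : exists l : lower_space Sigma, (lsup S <= set_val l)%O.
  exists l; split=> //=; apply: lower_space_cvg => x xl.
  (* If [vset x] rather than its complement is in [F], then [x] lies in [S], hence below [l]. *)
  have [|//] := in_ultra_setVsetC (vset x) FU.
  move=> Fx; case: xl; apply: le_trans jl.
  by have [+ _] := lsupP S; apply.
have [j1|/maxb [m mmax jm]] := eqVneq (lsup S) \top%O; last first.
  by exists (exist _ m (mem_set (maxS _ mmax))).
have [|F0 [F0fin F0S topF0]] := top_cpt S; first by rewrite j1.
have /filter_ex [l lF0] : F (vset (lsup F0)).
  exact: filter_vset_lsup.
by exists l; rewrite j1; exact: le_trans lF0.
Qed.

End LowerSpace.

Theorem proposition2p6 (d : Order.disp_t) (L : multLatticeType d)
    (k : elt_class) :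
  compactly_generated L ->
  compact_elt (\top%O : L) ->
  max_bounded L ->
  (forall m : L, maximal_elt m -> class_set L k m) ->
  cover_compact [set: lower_space (class_set L k)].
Proof.
move=> _ top_cpt maxb maxS.
by apply: compact_setT_cover; exact: lower_space_compact.
Qed.
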